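(* Let $n\ge 1$ and $k\ge 0$ be integers and let $\mathfrak h_{2n+1}$ denote the real Heisenberg Lie algebra of dimension $2n+1$. The Lie algebra $\mathfrak h_{2n+1}\times\mathbb R^{2k+1}$ admits an abelian balanced Hermitian structure $(J,F)$ if and only if $n\ge 2$.
   Context: $\mathfrak h_{2n+1}$ has a basis $e_1,\dots,e_{2n},z_0$ whose only non-zero brackets (up to skew-symmetry) are $[e_{2i-1},e_{2i}]=z_0$, $i=1,\dots,n$; $\mathbb R^{2k+1}$ is the abelian Lie algebra. A complex structure on a real Lie algebra $\mathfrak g$ is a linear map $J$ with $J^2=-\mathrm{Id}$ and $[JX,JY]-J[JX,Y]-J[X,JY]-[X,Y]=0$ for all $X,Y$; it is abelian if $[JX,JY]=[X,Y]$ for all $X,Y$. A Hermitian structure on $\mathfrak g$, $\dim\mathfrak g=2N$, is a pair $(J,g)$ with $J$ a complex structure and $g$ an inner product with $g(JX,JY)=g(X,Y)$, equivalently denoted $(J,F)$ with $F(X,Y)=g(X,JY)$. It is balanced if $d(F^{N-1})=0$, $d$ being the Chevalley-Eilenberg differential ($d\alpha(X,Y)=-\alpha([X,Y])$ for $\alpha\in\mathfrak g^*$). $(J,F)$ is an abelian balanced Hermitian structure if $J$ is abelian and $F$ is balanced. *)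

(* Defs.v *)
From HB Require Import structures.
From mathcomp Require Import all_boot all_order all_fingroup all_algebra.
From mathcomp Require Import reals.

Set Implicit Arguments.
Unset Strict Implicit.
Unset Printing Implicit Defensive.

Import GRing.Theory Num.Theory.

Local Open Scope ring_scope.

HB.mixin Record isLieAlgebra (R : fieldType) V of Vector R V := {
  lie : V -> V -> V;
  lie_linearl : forall y, linear (lie^~ y);
  lie_linearr : forall x, linear (lie x);
  lie_alt : forall x, lie x x = 0;
  lie_jacobi : forall x y z,
    lie x (lie y z) + lie y (lie z x) + lie z (lie x y) = 0
}.

#[short(type="lieAlgebraType")]
HB.structure Definition LieAlgebra (R : fieldType) :=
  {V of isLieAlgebra R V & Vector R V}.

Notation "[ 'lie' x , y ]" := (lie x y)
  (at level 0, x, y at level 99, format "[ 'lie'  x ,  y ]") : ring_scope.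

Section ProductLie.
Variables (R : fieldType) (g h : lieAlgebraType R).
Implicit Types x y z : (g * h)%type.

Definition prod_lie x y : (g * h)%type := ([lie x.1, y.1], [lie x.2, y.2]).

Fact prod_lie_linearl y : linear (prod_lie^~ y).
Proof. by move=> a u v; rewrite /prod_lie /= !lie_linearl. Qed.

Fact prod_lie_linearr x : linear (prod_lie x).
Proof. by move=> a u v; rewrite /prod_lie /= !lie_linearr. Qed.

Fact prod_lie_alt x : prod_lie x x = 0.
Proof. by rewrite /prod_lie !lie_alt. Qed.

Fact prod_lie_jacobi x y z :
  prod_lie x (prod_lie y z) + prod_lie y (prod_lie z x)
    + prod_lie z (prod_lie x y) = 0.
Proof. by congr pair; rewrite /= lie_jacobi. Qed.

HB.instance Definition _ := isLieAlgebra.Build R (g * h)%type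
  prod_lie_linearl prod_lie_linearr prod_lie_alt prod_lie_jacobi.
End ProductLie.

Definition abelian_lie (R : fieldType) (m : nat) : Type := 'rV[R]_m.

Section AbelianLie.
Variables (R : fieldType) (m : nat).
Local Notation V := (abelian_lie R m).

HB.instance Definition _ := Vector.on V.

Definition abelian_bracket (x y : V) : V := 0.

Fact abelian_linearl y : linear (abelian_bracket^~ y).
Proof. by move=> a u v; rewrite scaler0 addr0. Qed.

Fact abelian_linearr x : linear (abelian_bracket x).
Proof. by move=> a u v; rewrite scaler0 addr0. Qed.

Fact abelian_alt x : abelian_bracket x x = 0.
Proof. by []. Qed.

Fact abelian_jacobi x y z :
  abelian_bracket x (abelian_bracket y z) + abelian_bracket y (abelian_bracket z x)
    + abelian_bracket z (abelian_bracket x y) = 0.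
Proof. by rewrite !addr0. Qed.

HB.instance Definition _ := isLieAlgebra.Build R V
  abelian_linearl abelian_linearr abelian_alt abelian_jacobi.
End AbelianLie.

(* Indices start at 0: coordinate j < 2n of a row vector is the coefficient of
   e_(j+1), and the last coordinate is the coefficient of z_0. *)
Definition heisenberg (R : fieldType) (n : nat) : Type := 'rV[R]_(n.*2.+1).

Section HeisenbergLie.
Variables (R : fieldType) (n : nat).
Local Notation V := (heisenberg R n).

HB.instance Definition _ := Vector.on V.

Definition heis_e (j : nat) : V := delta_mx 0 (inord j : 'I_n.*2.+1).

Definition heis_z : V := delta_mx 0 ord_max.

Definition heis_coef (x : V) (j : nat) : R :=
  (x : 'rV[R]_(n.*2.+1)) 0 (inord j).

Definition heis_omega (x y : V) : R :=
  \sum_(i < n) (heis_coef x i.*2 * heis_coef y i.*2.+1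
                - heis_coef x i.*2.+1 * heis_coef y i.*2).

Definition heis_bracket (x y : V) : V := heis_omega x y *: heis_z.

Fact heis_coefP a u v j :
  heis_coef (a *: u + v) j = a * heis_coef u j + heis_coef v j.
Proof. by rewrite /heis_coef !mxE. Qed.

Fact heis_linearl y : linear (heis_bracket^~ y).
Proof.
move=> a u v; rewrite /heis_bracket scalerA -scalerDl; congr (_ *: _).
rewrite /heis_omega mulr_sumr -big_split; apply: eq_bigr => i _ /=.
by rewrite !heis_coefP !mulrDl !mulrBr !mulrA opprD addrACA.
Qed.

Fact heis_alt x : heis_bracket x x = 0.
Proof.
rewrite /heis_bracket /heis_omega big1 ?scale0r// => i _.
by rewrite [X in _ - X]mulrC subrr.
Qed.

Fact heis_anti x y : heis_bracket x y = - heis_bracket y x.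
Proof.
rewrite /heis_bracket -scaleNr /heis_omega -sumrN; congr (_ *: _).
by apply: eq_bigr => i _; rewrite opprB mulrC; congr (_ - _); rewrite mulrC.
Qed.

Fact heis_linearr x : linear (heis_bracket x).
Proof.
move=> a u v.
by rewrite heis_anti heis_linearl opprD -scalerN -!(heis_anti x).
Qed.

Fact heis_coef_z i : (i < n.*2)%N -> heis_coef heis_z i = 0.
Proof.
move=> lti; rewrite /heis_coef mxE eqxx /= -val_eqE /= inordK ?ltnS ?(ltnW lti)//.
by rewrite (ltn_eqF lti).
Qed.

Fact heis_nil x y z : heis_bracket x (heis_bracket y z) = 0.
Proof.
rewrite /heis_bracket {1}/heis_omega big1 ?scale0r// => i _.
have c0 j : (j < n.*2)%N -> heis_coef (heis_omega y z *: heis_z) j = 0.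
  by move=> ltj; rewrite -[_ *: _]addr0 heis_coefP heis_coef_z// mulr0 /heis_coef mxE addr0.
have lt1 : (i.*2.+1 < n.*2)%N by rewrite -doubleS leq_double.
by rewrite !c0 ?mulr0 ?subrr// ltnW.
Qed.

Fact heis_jacobi x y z :
  heis_bracket x (heis_bracket y z) + heis_bracket y (heis_bracket z x)
    + heis_bracket z (heis_bracket x y) = 0.
Proof. by rewrite !heis_nil !addr0. Qed.

HB.instance Definition _ := isLieAlgebra.Build R V
  heis_linearl heis_linearr heis_alt heis_jacobi.

Fact heis_coef_e c j : (c < n.*2)%N -> (j < n.*2)%N ->
  heis_coef (heis_e c) j = (j == c)%:R.
Proof.
move=> ltc ltj; rewrite /heis_coef mxE eqxx /=.
by rewrite -val_eqE /= !inordK ?ltnS ?(ltnW ltj) ?(ltnW ltc).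
Qed.

Fact heis_lie_e (i j : 'I_n) :
  [/\ [lie heis_e i.*2, heis_e j.*2.+1] = (i == j)%:R *: heis_z,
      [lie heis_e i.*2, heis_e j.*2] = 0 &
      [lie heis_e i.*2.+1, heis_e j.*2.+1] = 0].
Proof.
have lt1 (l : 'I_n) : (l.*2.+1 < n.*2)%N by rewrite -doubleS leq_double.
have lt0 (l : 'I_n) : (l.*2 < n.*2)%N := ltnW (lt1 l).
have eo a b : (a.*2.+1 == b.*2) = false.
  by apply/eqP => /(congr1 odd) /=; rewrite !odd_double.
have oe a b : (a.*2 == b.*2.+1) = false by rewrite eq_sym eo.
have eqd a b : (a.*2 == b.*2) = (a == b) by rewrite -!muln2 eqn_mul2r.
have eqo a b : (a.*2.+1 == b.*2.+1) = (a == b) by rewrite eqSS eqd.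
split; rewrite {1}/lie /= /heis_bracket /heis_omega.
- congr (_ *: _); rewrite (bigD1 i) //= big1 => [|l /negbTE neql].
    by rewrite !heis_coef_e// eqd eqo eo oe eqxx mul1r mul0r subr0 addr0.
  by rewrite !heis_coef_e// !(eqd, eqo, eo, oe) -val_eqE in neql *;
     rewrite neql !mul0r subr0.
- rewrite big1 ?scale0r// => l _.
  by rewrite !heis_coef_e// eo !(eqd, eqo, eo, oe) mulr0 mul0r subr0.
- rewrite big1 ?scale0r// => l _.
  by rewrite !heis_coef_e// !(eqd, eqo, eo, oe) mulr0 mul0r subr0.
Qed.

Fact heis_lie_z (x : V) : [lie x, heis_z] = 0.
Proof.
rewrite {1}/lie /= /heis_bracket /heis_omega big1 ?scale0r// => i _.
have lt1 : (i.*2.+1 < n.*2)%N by rewrite -doubleS leq_double.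
by rewrite !heis_coef_z ?mulr0 ?subrr// ltnW.
Qed.
End HeisenbergLie.

(* A p-form is a function of p vectors. The operations below are the usual ones
   on alternating multilinear functions, which are the only arguments they are
   meant for. *)
Definition extform (R : fieldType) (V : Type) (p : nat) := ('I_p -> V) -> R.

Section Forms.
Variables (R : fieldType) (V : Type).

Definition ext_wedge p q (a : extform R V p) (b : extform R V q) : extform R V (p + q) :=
  fun x => ((p`! * q`!)%:R)^-1 *
    \sum_(s : 'S_(p + q)) (-1) ^+ s *
      (a (fun i => x (s (lshift q i))) * b (fun j => x (s (rshift p j)))).

Fixpoint ext_pow (F : extform R V 2) (m : nat) : extform R V (m * 2) :=
  match m with
  | 0 => fun=> 1
  | m'.+1 => ext_wedge F (@ext_pow F m')
  end.
End Forms.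

Arguments ext_pow {R V} F m.

(* Chevalley-Eilenberg differential (trivial coefficients):
     (d a)(x_0,...,x_p) =
       \sum_(i < k) (-1)^(i+k) a([x_i,x_k], x_0,..,^x_i,..,^x_k,..,x_p).
   The pairs i < k are encoded as k = lift i j with i <= j (so that k = j + 1),
   and the remaining indices are lift i (lift j l). On 0-forms, d vanishes. *)
Definition CE_d (R : fieldType) (g : lieAlgebraType R) (p : nat) :
    extform R g p -> extform R g p.+1 :=
  match p with
  | 0 => fun _ _ => 0
  | q.+1 => fun a x =>
      \sum_(i < q.+2) \sum_(j < q.+1 | (i <= j)%N)
        (-1) ^+ (i + lift i j) *
        a (fun m => if unlift ord0 m is Some l then x (lift i (lift j l))
                    else [lie x i, x (lift i j)])
  end.

Section Hermitian.
Variables (R : realFieldType) (g : lieAlgebraType R).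
Implicit Types (J : 'End(g)) (ip : {dot g for idfun}).

Definition complex_structure J : Prop :=
  (forall x, J (J x) = - x) /\
  (forall x y, [lie J x, J y] - J [lie J x, y] - J [lie x, J y] - [lie x, y] = 0).

Definition abelian_J J : Prop := forall x y, [lie J x, J y] = [lie x, y].

Definition hermitian_structure J ip : Prop :=
  complex_structure J /\ (forall x y, ip (J x) (J y) = ip x y).

Definition fundamental_form J ip : extform R g 2 :=
  fun x => ip (x ord0) (J (x ord_max)).

(* With dim g = 2N, the exponent is N - 1. *)
Definition balanced J ip : Prop :=
  forall x, CE_d (ext_pow (fundamental_form J ip) (\dim {:g})./2.-1) x = 0.

Definition abelian_balanced_hermitian J ip : Prop :=
  [/\ hermitian_structure J ip, abelian_J J & balanced J ip].
End Hermitian.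

(* Main.v *)
Require Import Defs.
From HB Require Import structures.
From mathcomp Require Import all_boot all_order all_fingroup all_algebra.
From mathcomp Require Import reals boolp zify ring.

Set Implicit Arguments.
Unset Strict Implicit.
Unset Printing Implicit Defensive.

Import Order.TTheory GRing.Theory Num.Theory.

Local Open Scope ring_scope.

(** Write V for h_(2n+1) x R^(2k+1), of dimension 2N with N = n + k + 1, put
    M = N - 1, and write f(x, y) = g(x, J y), so that the power to study is
    F^M.  Every bracket of V is a multiple om(x, y) z of the central vector z.

    Two evaluations carry the proof.  If c_0, ..., c_(2m-1) is a sequence whose
    consecutive pairs (c_(2a), c_(2a+1)) are mutually f-orthogonal, then
    F^m(c_0, ..., c_(2m-1)) = m! prod_a f(c_(2a), c_(2a+1)) ([ext_pow_pairs]):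
    in the shuffle expansion of F /\ F^(m-1) only the pairs themselves survive.
    The differential of an alternating form has the same shape of expansion,
    with f(x_i, x_k) replaced by the insertion of [x_i, x_k]; both come from
    one regrouping of a sum over permutations ([sum_perm_shuffle]).

    Existence for n >= 2.  Take a basis in pairs: (z, w) with w in the abelian
    factor, the n pairs (e_(2i-1), e_(2i)), and pairs of abelian vectors.  Let J
    rotate pair a in the direction s_a = +1 or -1 and give both its vectors
    squared length mu_a.  Then J is abelian, and d(F^M) is an alternating
    multilinear form of degree 2N - 1.  It vanishes whenever z is among its
    arguments, so it is determined by its value on the basis deprived of z, and
    there the two evaluations give a multiple of
    sum_(1 <= a <= n) 1 / (mu_a s_a) ([abelian_balanced_of_trace]).  With n >= 2
    terms of free size and sign this sum can be made zero: one term is -1, the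
    n - 1 others are 1 / (n - 1).

    Obstruction for n = 1.  As J is abelian it preserves the centre, which has
    dimension 2k + 2.  A Gram-Schmidt argument yields a J-adapted orthogonal
    basis z, J z, u_1, J u_1, ... of the centre ([orthogonal_lines]).  In
    d(F^(k+1))(e_1, e_2, J z, u_1, J u_1, ...) only the bracket [e_1, e_2] = z is
    non-zero ([CE_d_central_tail]), so this value is, up to sign,
    F^(k+1)(z, J z, u_1, ...) = (k+1)! prod_a f(u_a, J u_a), which is not 0. *)

(** * Sums over permutations *)

(** A permutation is its value at 0 together with the permutation it induces
    on the remaining indices. *)
Lemma sum_lift_perm (V : nmodType) n (H : 'S_n.+1 -> V) :
  \sum_s H s = \sum_(i < n.+1) \sum_(t : 'S_n) H (lift_perm ord0 i t).
Proof.
rewrite (partition_big (fun s : 'S_n.+1 => s ord0) predT) //=.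
apply: eq_bigr => i _; rewrite (reindex (lift_perm ord0 i)) /=; last first.
  have unliftE (s : 'S_n.+1) k :
      lift (s ord0) (odflt k (unlift (s ord0) (s (lift ord0 k)))) = s (lift ord0 k).
    have := neq_lift ord0 k.
    by rewrite -(inj_eq (@perm_inj _ s)) => /unlift_some[? ? ->].
  have unlift_inj (s : 'S_n.+1) :
      injective (fun k => odflt k (unlift (s ord0) (s (lift ord0 k)))).
    by move=> k l /(congr1 (lift (s ord0))); rewrite !unliftE => /perm_inj/lift_inj.
  exists (fun s => perm (unlift_inj s)) => [t _ | s /eqP si].
    by apply/permP=> k; rewrite permE lift_perm_lift lift_perm_id liftK.
  apply/permP=> k; case: (unliftP ord0 k) => [k'|] ->; last by rewrite lift_perm_id.
  by rewrite lift_perm_lift permE -si unliftE.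
by apply: eq_bigl => t; rewrite lift_perm_id eqxx.
Qed.

(** The symmetry under exchange of the first two slots halves the sum to the
    permutations with s 0 < s 1; [j] is the position of s 1 among the indices
    other than [i = s 0], whence the condition [i <= j]. *)
Lemma sum_perm_swap01 (V : nmodType) p (H : 'S_p.+2 -> V) :
  (forall s : 'S_p.+2, H (tperm ord0 (lift ord0 ord0) * s)%g = H s) ->
  \sum_s H s =
  (\sum_(i < p.+2) \sum_(j < p.+1 | (i <= j)%N) \sum_(t : 'S_p)
     H (lift_perm ord0 i (lift_perm ord0 j t))) *+ 2.
Proof.
pose o1 : 'I_p.+2 := lift ord0 ord0.
move=> swapH; rewrite (bigID (fun s : 'S_p.+2 => (s ord0 < s o1)%N)) /= mulr2n.
have -> : \sum_(s : 'S_p.+2 | ~~ (s ord0 < s o1)%N) H s =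
          \sum_(s : 'S_p.+2 | (s ord0 < s o1)%N) H s.
  rewrite (reindex_inj (mulgI (tperm ord0 o1))) /=.
  apply: eq_big => [s|s _]; last exact: swapH.
  rewrite !permM tpermL tpermR -leqNgt ltn_neqAle; case: eqP => //=.
  by move/val_inj/perm_inj.
suff -> : \sum_(s : 'S_p.+2 | (s ord0 < s o1)%N) H s =
  \sum_(i < p.+2) \sum_(j < p.+1 | (i <= j)%N) \sum_(t : 'S_p)
     H (lift_perm ord0 i (lift_perm ord0 j t)) by [].
rewrite big_mkcond sum_lift_perm; apply: eq_bigr => i _.
rewrite sum_lift_perm [RHS]big_mkcond; apply: eq_bigr => j _.
have ij : (i < lift i j)%N = (i <= j)%N.
  by rewrite /= /bump; case: (leqP i j) => ij; rewrite ?add1n ?ltnS // add0n ltnNge (ltnW ij).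
case: ifP => lei; [apply: eq_bigr | apply: big1] => t _;
  by rewrite lift_perm_lift !lift_perm_id ij lei.
Qed.

(** The common source of the shuffle formula for a wedge with a 2-form and of
    the Chevalley-Eilenberg formula: a summand that depends on the first two
    values and, alternatingly, on the others becomes, once multiplied by the
    signature, constant on the [2 * p`!] permutations that share the pair
    {s 0, s 1}. *)
Lemma sum_perm_shuffle (R : pzRingType) p
    (h : 'I_p.+2 -> 'I_p.+2 -> ('I_p -> 'I_p.+2) -> R) :
  (forall i k r, h k i r = - h i k r) ->
  (forall i k r (t : 'S_p), h i k (r \o t) = (-1) ^+ t * h i k r) ->
  \sum_(s : 'S_p.+2) (-1) ^+ s *
     h (s ord0) (s (lift ord0 ord0)) (fun l => s (lift ord0 (lift ord0 l))) =
  (2 * p`!)%:R * \sum_(i < p.+2) \sum_(j < p.+1 | (i <= j)%N)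
     (-1) ^+ (i + j) * h i (lift i j) (fun l => lift i (lift j l)).
Proof.
move=> hC hperm; rewrite sum_perm_swap01 => [|s]; last first.
  rewrite !permM tpermL tpermR hC odd_permM odd_tperm eq_liftF signr_addb /= expr1.
  rewrite !mulN1r mulrNN; congr (_ * h _ _ _).
  by apply: funext => l; rewrite permM tpermD // -val_eqE.
rewrite natrM -mulrA mulr_natl; congr (_ *+ 2).
rewrite mulr_sumr; apply: eq_bigr => i _; rewrite mulr_sumr; apply: eq_bigr => j _.
rewrite (eq_bigr (fun=> (-1) ^+ (i + j) * h i (lift i j) (fun l => lift i (lift j l)))).
  by rewrite sumr_const card_Sn mulr_natl.
move=> t _; rewrite !(lift_perm_lift, lift_perm_id).
have -> : (fun l => lift_perm ord0 i (lift_perm ord0 j t) (lift ord0 (lift ord0 l)))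
        = (fun l => lift i (lift j l)) \o t.
  by apply: funext => l /=; rewrite !lift_perm_lift.
rewrite hperm !odd_lift_perm /= exprD -(signr_odd _ i) -(signr_odd _ j).
by case: odd; case: odd; case: (odd_perm t);
  rewrite /= !(expr0, expr1, mul1r, mulN1r, opprK).
Qed.

(** * Alternating and multilinear forms *)

Section MultilinearForms.
Variables (R : fieldType) (V : lmodType R).

Definition alternating p (a : extform R V p) :=
  forall x (s : 'S_p), a (x \o s) = (-1) ^+ s * a x.

Definition update p (x : 'I_p -> V) i v := fun j => if j == i then v else x j.

Definition multilinear p (a : extform R V p) :=
  forall x i c u v,
    a (update x i (c *: u + v)) = c * a (update x i u) + a (update x i v).

Lemma update_same p (x : 'I_p -> V) i : update x i (x i) = x.
Proof. by apply: funext => j; rewrite /update; case: eqP => // ->. Qed.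

Lemma update_eq p (x : 'I_p -> V) i v : update x i v i = v.
Proof. by rewrite /update eqxx. Qed.

Lemma update_neq p (x : 'I_p -> V) i j v : j != i -> update x i v j = x j.
Proof. by rewrite /update => /negbTE->. Qed.

Lemma update_inj p q (f : 'I_q -> 'I_p) (x : 'I_p -> V) k v :
  injective f -> update x (f k) v \o f = update (x \o f) k v.
Proof. by move=> injf; apply: funext => j; rewrite /update /= (inj_eq injf). Qed.

Lemma update_out p q (f : 'I_q -> 'I_p) (x : 'I_p -> V) i v :
  (forall k, f k != i) -> update x i v \o f = x \o f.
Proof. by move=> fi; apply: funext => j; rewrite /update /= (negbTE (fi j)). Qed.

Lemma multilinear0 p (a : extform R V p) x i :
  multilinear a -> x i = 0 -> a x = 0.
Proof.
move=> la xi0; have := la x i (-1) 0 0.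
by rewrite scaler0 addr0 -{1 2 3}xi0 update_same mulN1r addNr.
Qed.

Lemma multilinearZ p (a : extform R V p) x i c u :
  multilinear a -> a (update x i (c *: u)) = c * a (update x i u).
Proof.
move=> la; rewrite -[c *: u]addr0 la [X in _ + X](multilinear0 (i := i)) ?addr0 //.
by rewrite /update eqxx.
Qed.

Lemma multilinear_sum p (a : extform R V p) x i I (r : seq I) c (w : I -> V) :
  multilinear a ->
  a (update x i (\sum_(l <- r) c l *: w l)) = \sum_(l <- r) c l * a (update x i (w l)).
Proof.
move=> la; elim: r => [|l r IHr]; last by rewrite !big_cons la IHr.
by rewrite !big_nil (multilinear0 (i := i)) // /update eqxx.
Qed.

(** Arguments are moved to basis vectors one slot at a time: the induction is on
    the number of slots that may still hold arbitrary vectors. *)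
Lemma multilinear_span p (a : extform R V p) d (b : 'I_d -> V) (co : 'I_d -> V -> R) :
  multilinear a -> (forall v, v = \sum_i co i v *: b i) ->
  (forall f : 'I_p -> 'I_d, a (b \o f) = 0) -> forall x, a x = 0.
Proof.
move=> la bspan ab0 x.
suff H m : (m <= p)%N -> forall x, (forall i : 'I_p, (m <= i)%N -> exists l, x i = b l) -> a x = 0.
  by apply: (H p) => // i; rewrite leqNgt ltn_ord.
elim: m => [|m IHm] lemp {}x xb.
  have /choice[f xf] : forall i, exists l, x i = b l by move=> i; apply: xb.
  by rewrite -(ab0 f); congr a; apply: funext => i; apply: xf.
(* Expand the last slot not known to hold a basis vector. *)
pose i := Ordinal lemp; rewrite -(update_same x i) (bspan (x i)) multilinear_sum //.
rewrite big1 // => l _; rewrite IHm ?mulr0 1?ltnW // => k mk.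
rewrite /update; case: eqP => [_|/eqP ki]; first by exists l.
by apply: xb; rewrite ltn_neqAle mk eq_sym andbT.
Qed.

Lemma alternating_eq0 p (a : extform R V p) x i j :
  2%:R != 0 :> R -> alternating a -> i != j -> x i = x j -> a x = 0.
Proof.
move=> char2 alta ij xij; have := alta x (tperm i j).
rewrite odd_tperm ij expr1 mulN1r.
have -> : x \o tperm i j = x by apply: funext => k /=; case: tpermP => // ->.
move/eqP; rewrite -addr_eq0 -mulr2n -mulr_natl mulf_eq0 (negbTE char2) /=.
by move/eqP.
Qed.

Lemma alternating_wedge p q (a : extform R V p) (b : extform R V q) :
  alternating (ext_wedge a b).
Proof.
move=> x s; rewrite /ext_wedge mulrCA; congr (_ * _); rewrite mulr_sumr.
rewrite (reindex_inj (mulIg s^-1)%g) /=; apply: eq_bigr => t _.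
rewrite odd_permM odd_permV signr_addb -mulrA mulrCA; congr (_ * (_ * (_ * _))).
- by congr a; apply: funext => i /=; rewrite permM permKV.
- by congr b; apply: funext => i /=; rewrite permM permKV.
Qed.

(** In each summand of the wedge, slot [i] is fed to exactly one of the factors,
    namely the one whose block contains the preimage of [i]; the other factor
    does not see the update. *)
Lemma multilinear_wedge p q (a : extform R V p) (b : extform R V q) :
  multilinear a -> multilinear b -> multilinear (ext_wedge a b).
Proof.
move=> la lb x i c u v; rewrite /ext_wedge mulrCA -mulrDr; congr (_ * _).
rewrite mulr_sumr -big_split /=; apply: eq_bigr => s _.
rewrite [c * _]mulrCA -mulrDr; congr (_ * _).
have comp r (f : 'I_r -> 'I_(p + q)) w :
  (fun k => update x i w (f k)) = update x i w \o f by [].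
rewrite !(comp _ (fun k => s (lshift q k))) !(comp _ (fun k => s (rshift p k))).
have injl : injective (fun k => s (lshift q k)) by move=> k l /perm_inj/lshift_inj.
have injr : injective (fun k => s (rshift p k)) by move=> k l /perm_inj/rshift_inj.
case: (split_ordP (s^-1 i)%g) => k ki; rewrite -(permKV s i) ki.
- have outr l : s (rshift p l) != s (lshift q k) by rewrite (inj_eq perm_inj) eq_rlshift.
  by rewrite !(update_inj _ _ _ injl) !(update_out _ _ outr) la mulrDl mulrA.
- have outl l : s (lshift q l) != s (rshift p k) by rewrite (inj_eq perm_inj) eq_lrshift.
  by rewrite !(update_inj _ _ _ injr) !(update_out _ _ outl) lb mulrDr mulrCA.
Qed.

Lemma alternating_ext_pow F m : alternating (ext_pow F m : extform R V _).
Proof.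
case: m => [|m]; last exact: alternating_wedge.
by move=> x s; rewrite /= (_ : s = 1%g) ?odd_perm1 ?mul1r //; apply/permP; case.
Qed.

Lemma multilinear_ext_pow F m :
  multilinear F -> multilinear (ext_pow F m : extform R V _).
Proof.
move=> lF; elim: m => [|m IHm]; last exact: multilinear_wedge.
by move=> x [].
Qed.

End MultilinearForms.

(** * Wedge with a 2-form and the Chevalley-Eilenberg differential *)

Section Expansions.
Variables (R : numFieldType).

Lemma wedge2E (V : lmodType R) p (f : V -> V -> R) (G : extform R V p) (x : 'I_p.+2 -> V) :
  (forall u v, f v u = - f u v) ->
  alternating G ->
  @ext_wedge R V 2 p (fun y => f (y ord0) (y ord_max)) G x =
  \sum_(i < p.+2) \sum_(j < p.+1 | (i <= j)%N)
     (-1) ^+ (i + j) * (f (x i) (x (lift i j)) * G (fun l => x (lift i (lift j l)))).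
Proof.
move=> fC altG; rewrite /ext_wedge.
pose h i k (r : 'I_p -> 'I_p.+2) := f (x i) (x k) * G (x \o r).
have hC i k r : h k i r = - h i k r by rewrite /h fC mulNr.
have hperm i k r (t : 'S_p) : h i k (r \o t) = (-1) ^+ t * h i k r.
  by rewrite /h mulrCA -altG.
have hE := sum_perm_shuffle hC hperm.
apply: (canLR (mulKf _)); first by rewrite pnatr_eq0 -lt0n muln_gt0 !fact_gt0.
rewrite -hE; apply: eq_bigr => s _; rewrite /h; congr (_ * (f (x (s _)) (x (s _)) * _)).
- exact: val_inj.
- exact: val_inj.
- by congr G; apply: funext => l /=; congr (x (s _)); apply: val_inj.
Qed.

Definition fcons (V : Type) p (v : V) (r : 'I_p -> V) : 'I_p.+1 -> V :=
  fun m => if unlift ord0 m is Some l then r l else v.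

Lemma fcons0 (V : Type) p (v : V) (r : 'I_p -> V) : fcons v r ord0 = v.
Proof. by rewrite /fcons unlift_none. Qed.

Lemma fconsS (V : Type) p (v : V) (r : 'I_p -> V) l : fcons v r (lift ord0 l) = r l.
Proof. by rewrite /fcons liftK. Qed.

Lemma fcons_perm (V : Type) p (v : V) (r : 'I_p -> V) (t : 'S_p) :
  fcons v (r \o t) = fcons v r \o lift_perm ord0 ord0 t.
Proof.
apply: funext => m /=; case: (unliftP ord0 m) => [l|] ->.
  by rewrite lift_perm_lift !fconsS.
by rewrite lift_perm_id !fcons0.
Qed.

Lemma update_fcons0 (V : lmodType R) p (v w : V) (r : 'I_p -> V) :
  update (fcons v r) ord0 w = fcons w r.
Proof.
apply: funext => m; rewrite /update; case: (unliftP ord0 m) => [l|] ->.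
  by rewrite lift_eqF !fconsS.
by rewrite eqxx fcons0.
Qed.

Lemma update_fconsS (V : lmodType R) p (v w : V) (r : 'I_p -> V) i :
  update (fcons v r) (lift ord0 i) w = fcons v (update r i w).
Proof.
apply: funext => m; rewrite /update; case: (unliftP ord0 m) => [l|] ->.
  by rewrite (inj_eq lift_inj) !fconsS.
by rewrite eq_liftF !fcons0.
Qed.

Variable g : lieAlgebraType R.

Lemma lieDl (x y z : g) : [lie (x + y), z] = [lie x, z] + [lie y, z].
Proof. by rewrite -{1}[x]scale1r lie_linearl scale1r. Qed.

Lemma lieDr (x y z : g) : [lie z, (x + y)] = [lie z, x] + [lie z, y].
Proof. by rewrite -{1}[x]scale1r lie_linearr scale1r. Qed.

Lemma lieC (x y : g) : [lie y, x] = - [lie x, y].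
Proof.
have := lie_alt (x + y); rewrite lieDl !lieDr !lie_alt add0r addr0 addrC.
by move/eqP; rewrite addr_eq0 => /eqP.
Qed.

Lemma lieNr (x y : g) : [lie x, - y] = - [lie x, y].
Proof.
have := lie_linearr x (-1) y y; rewrite !scaleN1r !addNr => lie0.
by apply/eqP; rewrite -addr_eq0 -lieDr addNr lie0.
Qed.

Lemma CE_dE q (a : extform R g q.+1) x :
  CE_d a x = \sum_(i < q.+2) \sum_(j < q.+1 | (i <= j)%N)
    (-1) ^+ (i + lift i j) *
    a (fcons [lie x i, x (lift i j)] (fun l => x (lift i (lift j l)))).
Proof. by []. Qed.

Lemma sign_lift p (i : 'I_p.+1) (j : 'I_p) : (i <= j)%N ->
  (-1) ^+ (i + lift i j) = - (-1) ^+ (i + j) :> R.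
Proof. by move=> lij; rewrite /= /bump lij addnCA exprS mulN1r. Qed.

(** The differential as a full antisymmetrization.  In this form its alternating
    character is a change of summation variable, which is hard to see on the
    sum over i < k. *)
Lemma CE_d_permE q (a : extform R g q.+1) x : alternating a -> multilinear a ->
  CE_d a x = - (2 * q`!)%:R^-1 * \sum_(s : 'S_q.+2) (-1) ^+ s *
    a (fcons [lie x (s ord0), x (s (lift ord0 ord0))]
             (fun l => x (s (lift ord0 (lift ord0 l))))).
Proof.
move=> alta la.
pose h i k (r : 'I_q -> 'I_q.+2) := a (fcons [lie x i, x k] (x \o r)).
have hC i k r : h k i r = - h i k r.
  rewrite /h lieC -scaleN1r -(update_fcons0 0) multilinearZ // mulN1r.
  by rewrite update_fcons0.
have hperm i k r (t : 'S_q) : h i k (r \o t) = (-1) ^+ t * h i k r.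
  by rewrite /h -[x \o _]/((x \o r) \o t) fcons_perm alta odd_lift_perm.
have hE := sum_perm_shuffle hC hperm; rewrite [X in _ * X]hE mulNr mulKf; last first.
  by rewrite pnatr_eq0 -lt0n muln_gt0 fact_gt0.
rewrite CE_dE -sumrN; apply: eq_bigr => i _; rewrite -sumrN.
by apply: eq_bigr => j lij; rewrite sign_lift // mulNr.
Qed.

Lemma alternating_CE_d q (a : extform R g q.+1) :
  alternating a -> multilinear a -> alternating (CE_d a).
Proof.
move=> alta la x s; rewrite !CE_d_permE // mulrCA; congr (_ * _).
rewrite (reindex_inj (mulIg s^-1)%g) mulr_sumr /=; apply: eq_bigr => t _.
rewrite mulrA odd_permM odd_permV signr_addb [_ * (-1) ^+ s]mulrC.
rewrite !permM !permKV; congr (_ * a (fcons _ _)).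
by apply: funext => l; rewrite permM permKV.
Qed.

(** In the (i, j) term, slot [k] is the left entry of the bracket, its right
    entry, or one of the slots left after the bracket. *)
Lemma multilinear_CE_d q (a : extform R g q.+1) :
  multilinear a -> multilinear (CE_d a).
Proof.
move=> la x k c u v; rewrite !CE_dE mulr_sumr -big_split /=; apply: eq_bigr => i _.
rewrite mulr_sumr -big_split /=; apply: eq_bigr => j _.
rewrite [c * _]mulrCA -mulrDr; congr (_ * _).
have comp r (f : 'I_r -> 'I_q.+2) w :
  (fun l => update x k w (f l)) = update x k w \o f by [].
rewrite !(comp _ (fun l => lift i (lift j l))).
have inj2 : injective (fun l => lift i (lift j l)) by move=> l m /lift_inj/lift_inj.
have la0 r w w' c' : a (fcons (c' *: w + w') r) = c' * a (fcons w r) + a (fcons w' r).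
  by have := la (fcons 0 r) ord0 c' w w'; rewrite !update_fcons0.
case: (unliftP i k) => [k'|] ->; last first.
  have out l : lift i (lift j l) != i by rewrite lift_eqF.
  have lijE : lift i j != i by rewrite lift_eqF.
  by rewrite !(update_out _ _ out) !update_eq !(update_neq _ _ lijE) lie_linearl la0.
case: (unliftP j k') => [l|] ->; last first.
  have out l : lift i (lift j l) != lift i j by rewrite (inj_eq lift_inj) lift_eqF.
  have lijE : i != lift i j by rewrite eq_liftF.
  by rewrite !(update_out _ _ out) !update_eq !(update_neq _ _ lijE) lie_linearr la0.
have out0 : i != lift i (lift j l) by rewrite eq_liftF.
have out1 : lift i j != lift i (lift j l) by rewrite (inj_eq lift_inj) eq_liftF.
rewrite !(update_inj _ _ _ inj2) !(update_neq _ _ out0) !(update_neq _ _ out1).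
by rewrite -!update_fconsS la.
Qed.

End Expansions.

(** * Powers of a 2-form on a sequence of orthogonal pairs *)

Lemma sum_triangle_diag (V : nmodType) p (T : nat -> nat -> V) :
  (forall i j, (i < j)%N -> (j < p)%N -> T i j = 0) ->
  \sum_(i < p.+1) \sum_(j < p | (i <= j)%N) T i j = \sum_(i < p) T i i.
Proof.
move=> T0; rewrite big_ord_recr /= [X in _ + X]big1 ?addr0 => [|j]; last first.
  by rewrite leqNgt ltn_ord.
apply: eq_bigr => i _; rewrite (bigD1 i) //= big1 ?addr0 // => j /andP[lij].
by rewrite eq_sym => ij; rewrite T0 // ltn_neqAle lij andbT.
Qed.

Lemma sum_even_index (V : nmodType) m (E : nat -> V) :
  (forall a, (a < m)%N -> E a.*2.+1 = 0) ->
  \sum_(i < (m * 2).+1) E i = \sum_(a < m.+1) E a.*2.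
Proof.
elim: m => [|m IHm] E0; first by rewrite !big_ord1.
rewrite muln2 doubleS [RHS]big_ord_recr /= -IHm => [|a am]; last by rewrite E0 // ltnW.
by rewrite muln2 2!big_ord_recr /= (E0 m) ?addr0.
Qed.

Lemma sum_odd_index (V : nmodType) m (E : nat -> V) :
  (forall a, (a < m)%N -> E a.*2 = 0) ->
  \sum_(i < m * 2) E i = \sum_(a < m) E a.*2.+1.
Proof.
elim: m => [|m IHm] E0; first by rewrite !big_ord0.
rewrite muln2 doubleS [RHS]big_ord_recr /= -IHm => [|a am]; last by rewrite E0 // ltnW.
by rewrite muln2 2!big_ord_recr /= (E0 m) ?addr0.
Qed.

(** Removing the indices 2a and 2a+1 is a double bump at 2a; on the sequence of
    pairs it is a single bump at a. *)
Lemma bump_double a i : bump a.*2 (bump a.*2 i) = if (i < a.*2)%N then i else i.+2.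
Proof. rewrite /bump; do ?case: leqP => ?; lia. Qed.

Lemma bump_double_even a b : bump a.*2 (bump a.*2 b.*2) = (bump a b).*2.
Proof. rewrite /bump; do ?case: leqP => ?; lia. Qed.

Lemma bump_double_odd a b : bump a.*2 (bump a.*2 b.*2.+1) = (bump a b).*2.+1.
Proof. rewrite /bump; do ?case: leqP => ?; lia. Qed.

Lemma half_bump_double a i : (bump a.*2 (bump a.*2 i))./2 = bump a i./2.
Proof. rewrite /bump; do ?case: leqP => ?; lia. Qed.

Section PairedPower.
Variables (R : numFieldType) (V : lmodType R) (f : V -> V -> R).
Hypothesis fC : forall u v, f v u = - f u v.

Let F : extform R V 2 := fun y => f (y ord0) (y ord_max).

(** Induction on [m]: in F /\ F^m only the terms that feed a pair (2a, 2a+1) to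
    F survive; each of them has sign +1 and, by induction on the sequence
    without that pair, the same value, so that they contribute a factor m + 1. *)
Lemma ext_pow_pairs m (c : nat -> V) :
  (forall i j, (i < m * 2)%N -> (j < m * 2)%N -> i./2 != j./2 -> f (c i) (c j) = 0) ->
  ext_pow F m (fun i => c i) = m`!%:R * \prod_(a < m) f (c a.*2) (c a.*2.+1).
Proof.
elim: m c => [|m IHm] c f0; first by rewrite /= big_ord0 mulr1.
rewrite [LHS](wedge2E _ fC); last exact: alternating_ext_pow.
pose T i j : R := (-1) ^+ (i + j) *
  (f (c i) (c (bump i j)) * ext_pow F m (fun l => c (bump i (bump j l)))).
rewrite -[LHS]/(\sum_(i < (m * 2).+2) \sum_(j < (m * 2).+1 | (i <= j)%N) T i j).
have T0 i j : (i <= j)%N -> (j < (m * 2).+1)%N -> i./2 != j.+1./2 -> T i j = 0.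
  by move=> lij ljm ij; rewrite /T f0 ?mul0r ?mulr0 // /bump; lia.
(* f (c i) (c j.+1) vanishes unless i = j is even. *)
rewrite sum_triangle_diag => [|i j lij ljm]; last by apply: T0; lia.
rewrite (sum_even_index (E := fun i => T i i)) => [|a am]; last by apply: T0; lia.
set P := \prod_(a < m.+1) _.
have -> : (m.+1)`!%:R * P = \sum_(a < m.+1) m`!%:R * P.
  by rewrite sumr_const card_ord factS natrM -mulrA mulr_natl.
apply: eq_bigr => a _; rewrite /T addnn -signr_odd odd_double mul1r.
rewrite (IHm (fun l => c (bump a.*2 (bump a.*2 l)))) => [|i j im jm ij]; last first.
  have am := ltn_ord a.
  by apply: f0; rewrite ?half_bump_double ?(can_eq (bumpK _)) // bump_double; case: ifP; lia.
rewrite /P (bigD1_ord a) //= mulrCA; congr (_ * (f _ (c _) * _)); first by rewrite /bump leqnn.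
by apply: eq_bigr => b _; rewrite bump_double_even bump_double_odd.
Qed.

End PairedPower.

(** * The differential of a power when all brackets are central *)

Section Differential.
Variables (R : numFieldType) (g : lieAlgebraType R).

Lemma multilinear_fcons0 q (a : extform R g q.+1) r : multilinear a -> a (fcons 0 r) = 0.
Proof. by move=> la; rewrite (multilinear0 (i := ord0)) ?fcons0. Qed.

Lemma multilinear_fconsZ q (a : extform R g q.+1) c v r :
  multilinear a -> a (fcons (c *: v) r) = c * a (fcons v r).
Proof. by move=> la; rewrite -(update_fcons0 0) multilinearZ // update_fcons0. Qed.

(** All brackets other than that of the first two arguments involve a central
    vector. *)
Lemma CE_d_central_tail q (a : extform R g q.+1) u v (r : 'I_q -> g) :
  multilinear a -> (forall l y, [lie y, r l] = 0) ->
  CE_d a (fcons u (fcons v r)) = - a (fcons [lie u, v] r).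
Proof.
move=> la rcentral; rewrite CE_dE.
have T0 (i : 'I_q.+2) (j : 'I_q.+1) : (i <= j)%N -> j != ord0 ->
    [lie fcons u (fcons v r) i, fcons u (fcons v r) (lift i j)] = 0.
  move=> lij j0; have [l ->] : exists l, lift i j = lift ord0 (lift ord0 l).
    case: (unliftP ord0 j) j0 lij => [l|] -> //= _ lij; exists l; apply: val_inj.
    by rewrite /= /bump lij.
  by rewrite !fconsS rcentral.
rewrite (bigD1 ord0) //= (bigD1 ord0) //= [X in _ + X + _]big1 => [|j j0]; last first.
  by rewrite T0 // multilinear_fcons0 // mulr0.
rewrite [X in _ + _ + X]big1 => [|i i0]; last first.
  apply: big1 => j lij; rewrite T0 ?multilinear_fcons0 ?mulr0 //.
  by apply: contraNneq i0 => j0; rewrite -val_eqE /= -leqn0 -[0%N]/(val (ord0 : 'I_q.+1)) -j0.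
rewrite !addr0 /= expr1 mulN1r fcons0 !fconsS fcons0; congr (- a (fcons _ _)).
by apply: funext => l; rewrite !fconsS.
Qed.

Section HeisenbergBracket.
Variables (z : g) (om : g -> g -> R).
Hypothesis lieE : forall x y, [lie x, y] = om x y *: z.
Hypothesis zcentral : forall x, [lie x, z] = 0.

(** When z is one of the arguments, either it is bracketed, which gives 0, or it
    stays next to a bracket, which is a multiple of z, and the form alternates. *)
Lemma CE_d_at_center q (a : extform R g q.+1) x m :
  alternating a -> multilinear a -> x m = z -> CE_d a x = 0.
Proof.
move=> alta la xm; rewrite CE_dE big1 // => i _; rewrite big1 // => j _.
case: (unliftP i m) xm => [m'|] -> xm; last first.
  by rewrite xm lieC zcentral oppr0 multilinear_fcons0 ?mulr0.
case: (unliftP j m') xm => [l|] -> xm; last first.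
  by rewrite xm zcentral multilinear_fcons0 ?mulr0.
rewrite lieE multilinear_fconsZ // (alternating_eq0 (i := ord0) (j := lift ord0 l)) ?mulr0 //.
  by rewrite pnatr_eq0.
by rewrite fcons0 fconsS xm.
Qed.

Variables (f : g -> g -> R) (m : nat) (c : nat -> g) (w : nat -> R).
Hypothesis fC : forall u v, f v u = - f u v.
Hypothesis f_linear : forall k u v x, f x (k *: u + v) = k * f x u + f x v.
Let M := m.+1.
Let F : extform R g 2 := fun y => f (y ord0) (y ord_max).
Hypothesis c0 : c 0 = z.
Hypothesis f_pairs : forall i j, (i < M.+1 * 2)%N -> (j < M.+1 * 2)%N ->
  i./2 != j./2 -> f (c i) (c j) = 0.
Hypothesis lie_unpaired : forall i j, (i < M.+1 * 2)%N -> (j < M.+1 * 2)%N ->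
  i./2 != j./2 -> [lie c i, c j] = 0.
Hypothesis lie_paired : forall a, (a < M)%N ->
  [lie c a.+1.*2, c a.+1.*2.+1] = w a *: z.

Lemma multilinear_form2 : multilinear F.
Proof.
have f_linearl k u v x : f (k *: u + v) x = k * f u x + f v x.
  by rewrite fC f_linear opprD -mulrN -!fC.
move=> x i k u v; rewrite /F; have [->|i0] := eqVneq i ord0.
  by rewrite !update_eq !update_neq.
have -> : i = ord_max.
  by apply: val_inj; case: i i0 => [[|[|]]].
by rewrite !update_eq !update_neq.
Qed.

Let pow_alt : alternating (ext_pow F M) := alternating_ext_pow F (m:=M).
Let pow_lin : multilinear (ext_pow F M) := multilinear_ext_pow (m:=M) multilinear_form2.

(** With z = c_0 left out, the surviving brackets are those of the pairs a + 1,
    and inserting a bracket puts z back in front of its partner c_1: what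
    remains is the paired sequence without the pair a + 1. *)
Lemma CE_d_pairs :
  CE_d (ext_pow F M) (fun i => c i.+1) =
  - (M`!%:R * \sum_(a < M) w a * \prod_(b < M) f (c (bump a.+1 b).*2) (c (bump a.+1 b).*2.+1)).
Proof.
rewrite [LHS]CE_dE.
pose T i j : R := (-1) ^+ (i + bump i j) * ext_pow F M
  (fcons [lie c i.+1, c (bump i j).+1]
     (fun l : 'I_(m * 2).+1 => c (bump i (bump j l)).+1)).
rewrite -[LHS]/(\sum_(i < (M * 2).+1) \sum_(j < M * 2 | (i <= j)%N) T i j).
have T0 i j : (i <= j)%N -> (j < M * 2)%N -> i.+1./2 != j.+2./2 -> T i j = 0.
  move=> lij ljm ij; have bij : bump i j = j.+1 by rewrite /bump lij.
  by rewrite /T bij lie_unpaired ?multilinear_fcons0 ?mulr0 //; lia.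
(* The bracket of c_(i+1) and c_(j+2) is zero unless they form a pair, that is,
   unless i = j is odd. *)
rewrite sum_triangle_diag => [|i j lij ljm]; last by apply: T0; lia.
rewrite (sum_odd_index (E := fun i => T i i)) => [|a am]; last by apply: T0; lia.
rewrite mulr_sumr -sumrN; apply: eq_bigr => a _.
have am := ltn_ord a.
rewrite /T /bump leqnn add1n -/(bump _ _) addnS addnn -signr_odd /= odd_double expr1.
rewrite mulN1r; congr (- _).
rewrite -doubleS lie_paired // multilinear_fconsZ // [RHS]mulrCA; congr (_ * _).
pose ca l := c (bump a.+1.*2 (bump a.+1.*2 l)).
rewrite (eq_bigr (fun b : 'I_M => f (ca b.*2) (ca b.*2.+1))) => [|b _]; last first.
  by rewrite /ca bump_double_even bump_double_odd.
rewrite -(@ext_pow_pairs _ _ f fC M ca) => [|i j im jm ij].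
  congr (ext_pow F M); apply: funext => k; rewrite /ca.
  case: (unliftP ord0 k) => [l|] ->; first by rewrite fconsS /= doubleS !bumpS.
  by rewrite fcons0 /= bump_double.
apply: f_pairs; rewrite ?half_bump_double ?(can_eq (bumpK _)) // bump_double; case: ifP; lia.
Qed.

(** The degree is one less than the number of basis vectors, so a tuple of
    distinct basis vectors avoiding z is a permutation of all the others; the
    single value computed in [CE_d_pairs] decides. *)
Lemma CE_d_pow_eq0 (co : 'I_(M.+1 * 2) -> g -> R) :
  (forall v, v = \sum_i co i v *: c i) ->
  \sum_(a < M) w a * \prod_(b < M) f (c (bump a.+1 b).*2) (c (bump a.+1 b).*2.+1) = 0 ->
  forall x, CE_d (ext_pow F M) x = 0.
Proof.
move=> cspan w0.
have alt_d : alternating (CE_d (ext_pow F M)).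
  exact: (alternating_CE_d pow_alt pow_lin).
have lin_d : multilinear (CE_d (ext_pow F M)).
  exact: (multilinear_CE_d pow_lin).
apply: (multilinear_span (b := fun i : 'I_(M.+1 * 2) => c i) lin_d cspan) => h.
have [/existsP[l /eqP hl]|/existsPn hne0] := boolP [exists l, h l == ord0].
  by apply: (CE_d_at_center (m := l)); rewrite //= hl.
have /choice[s hs] : forall l, exists s, h l = lift ord0 s.
  by move=> l; case: (unliftP ord0 (h l)) (hne0 l) => [s|] ->; [exists s|rewrite eqxx].
have [/injectiveP s_inj|/injectivePn[i [j ij sij]]] := boolP (injectiveb s).
  have -> : (fun i : 'I_(M.+1 * 2) => c i) \o h =
            (fun i : 'I_(M * 2).+1 => c i.+1) \o perm s_inj.
    by apply: funext => l /=; rewrite hs permE.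
  by rewrite alt_d CE_d_pairs w0 mulr0 oppr0 mulr0.
by apply: (alternating_eq0 _ alt_d ij); rewrite ?pnatr_eq0 //= !hs sij.
Qed.

End HeisenbergBracket.
End Differential.

(** * Abelian Hermitian structures adapted to a paired basis *)

Lemma sum_pairs (V : nmodType) m (E : nat -> V) :
  \sum_(i < m * 2) E i = \sum_(a < m) (E a.*2 + E a.*2.+1).
Proof.
elim: m => [|m IHm]; first by rewrite !big_ord0.
by rewrite mulSn [RHS]big_ord_recr /= -IHm 2!big_ord_recr /= muln2 addrA.
Qed.

Lemma eq_double a b : (a.*2 == b.*2) = (a == b).
Proof. lia. Qed.

Lemma eq_doubleS a b : (a.*2 == b.*2.+1) = false.
Proof. lia. Qed.

Lemma eq_Sdouble a b : (a.*2.+1 == b.*2) = false.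
Proof. lia. Qed.

Definition eq_doubleE := (eqSS, eq_double, eq_doubleS, eq_Sdouble).

Lemma dot_exists (R : realFieldType) (V : lmodType R) (q : V -> V -> R) :
  (forall k u v x, q x (k *: u + v) = k * q x u + q x v) ->
  (forall x y, q y x = q x y) -> (forall x, x != 0 -> 0 < q x x) ->
  exists ip : {dot V for idfun}, forall x y, ip x y = q x y.
Proof.
move=> q_linr qC q_pos.
have linr x : GRing.linear_for *%R (q x) by move=> k u v; apply: q_linr.
have linl y : GRing.linear_for *%R (q^~ y).
  by move=> k u v; rewrite ![q _ y]qC q_linr.
pose bil := isBilinear.Build R V V R *%R (idfun \; *%R) q
  (fun y => GRing.zmod_morphism_linear (linl y))
  (fun x => GRing.zmod_morphism_linear (linr x))
  (fun y => GRing.scalable_linear (linl y))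
  (fun x => GRing.scalable_linear (linr x)).
have herm x y : q x y = (-1) ^+ false * idfun (q y x) by rewrite mul1r qC.
pose hrm := isHermitianSesquilinear.Build R V false idfun q herm.
pose dt := isDotProduct.Build R V q q_pos.
pose ip : {dot V for idfun} := HB.pack q bil hrm dt.
by exists ip.
Qed.

Section AdaptedBasis.
Variables (R : realFieldType) (g : lieAlgebraType R) (N : nat).
Variables (c : nat -> g) (co : nat -> g -> R) (s mu : nat -> R).
Hypothesis co_linear : forall i k u v, co i (k *: u + v) = k * co i u + co i v.
Hypothesis co_dual : forall i j, (i < N * 2)%N -> (j < N * 2)%N -> co i (c j) = (i == j)%:R.
Hypothesis co_sep : forall x, (forall i, (i < N * 2)%N -> co i x = 0) -> x = 0.
Hypothesis s_sign : forall a, s a * s a = 1.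
Hypothesis mu_gt0 : forall a, 0 < mu a.

Let coL i : {linear g -> R^o} :=
  HB.pack (co i : g -> R^o) (GRing.isLinear.Build R g R^o _ (co i : g -> R^o) (co_linear i)).

Lemma coord0 i : co i 0 = 0.
Proof. exact: (linear0 (coL i)). Qed.

Lemma coordD i u v : co i (u + v) = co i u + co i v.
Proof. exact: (linearD (coL i)). Qed.

Lemma coordN i u : co i (- u) = - co i u.
Proof. exact: (linearN (coL i)). Qed.

Lemma coordZ i k u : co i (k *: u) = k * co i u.
Proof. by rewrite -[k *: u]addr0 co_linear coord0 addr0. Qed.

Lemma coord_sum i I (r : seq I) P (F : I -> g) :
  co i (\sum_(l <- r | P l) F l) = \sum_(l <- r | P l) co i (F l).
Proof. exact: (linear_sum (coL i)). Qed.

Lemma adapted_span x : x = \sum_(i < N * 2) co i x *: c i.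
Proof.
apply/eqP; rewrite -subr_eq0; apply/eqP; apply: co_sep => i iN.
rewrite coordD coordN coord_sum (bigD1 (Ordinal iN)) //= big1 => [|j ji].
  by rewrite coordZ co_dual // eqxx mulr1 addr0 subrr.
rewrite coordZ co_dual // -[i]/(val (Ordinal iN)) val_eqE eq_sym (negbTE ji).
by rewrite mulr0.
Qed.

(** Rotates the a-th pair: c_(2a) goes to s_a c_(2a+1), and c_(2a+1) to
    - s_a c_(2a). *)
Definition pairJ x : g :=
  \sum_(a < N) s a *: (co a.*2 x *: c a.*2.+1 - co a.*2.+1 x *: c a.*2).

Definition pair_dot x y : R :=
  \sum_(a < N) mu a * (co a.*2 x * co a.*2 y + co a.*2.+1 x * co a.*2.+1 y).

Lemma pairJ_linear : linear pairJ.
Proof.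
move=> k u v; rewrite /pairJ scaler_sumr -big_split /=; apply: eq_bigr => a _.
rewrite !co_linear [k *: (_ *: _)]scalerA [k * s a]mulrC -scalerA -scalerDr; congr (_ *: _).
by rewrite !scalerDl -!scalerA opprD scalerBr addrACA.
Qed.

Lemma coord_pairJ a x : (a < N)%N ->
  co a.*2 (pairJ x) = - (s a * co a.*2.+1 x) /\ co a.*2.+1 (pairJ x) = s a * co a.*2 x.
Proof.
move=> aN; have E (b : 'I_N) i : (i < N * 2)%N ->
    co i (s b *: (co b.*2 x *: c b.*2.+1 - co b.*2.+1 x *: c b.*2)) =
    s b * (co b.*2 x * (i == b.*2.+1)%:R - co b.*2.+1 x * (i == b.*2)%:R).
  have := ltn_ord b => bN iN.
  by rewrite coordZ coordD coordN !coordZ !co_dual //; lia.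
rewrite /pairJ !coord_sum; split; rewrite (bigD1 (Ordinal aN)) //= big1 ?addr0.
- rewrite (E (Ordinal aN)) /=; last lia.
  by rewrite !eq_doubleE eqxx mulr0 mulr1 sub0r mulrN.
- move=> b; rewrite -val_eqE eq_sym /= => /negbTE ba; rewrite E; last lia.
  by rewrite !eq_doubleE ba !mulr0 subr0 mulr0.
- rewrite (E (Ordinal aN)) /=; last lia.
  by rewrite !eq_doubleE eqxx mulr0 mulr1 subr0.
- move=> b; rewrite -val_eqE eq_sym /= => /negbTE ba; rewrite E; last lia.
  by rewrite !eq_doubleE ba !mulr0 subr0 mulr0.
Qed.

Lemma pairJK x : pairJ (pairJ x) = - x.
Proof.
rewrite {2}(adapted_span x) (sum_pairs N (fun i => co i x *: c i)) -sumrN.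
apply: eq_bigr => a _; have [-> ->] := coord_pairJ x (ltn_ord a).
by rewrite scalerBr scaleNr scalerN !scalerA !mulrA s_sign !mul1r opprD addrC.
Qed.

Lemma pair_dotC x y : pair_dot y x = pair_dot x y.
Proof. by apply: eq_bigr => a _; rewrite !(mulrC (co _ y)). Qed.

Lemma pair_dot_linear k u v x : pair_dot x (k *: u + v) = k * pair_dot x u + pair_dot x v.
Proof.
rewrite /pair_dot mulr_sumr -big_split /=; apply: eq_bigr => a _; rewrite !co_linear.
ring.
Qed.

Lemma pair_dot_gt0 x : x != 0 -> 0 < pair_dot x x.
Proof.
have ge0 (a : 'I_N) : true ->
    0 <= mu a * (co a.*2 x * co a.*2 x + co a.*2.+1 x * co a.*2.+1 x).
  by move=> _; rewrite mulr_ge0 ?(ltW (mu_gt0 _)) // addr_ge0 // -expr2 sqr_ge0.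
rewrite lt_def sumr_ge0 // andbT; apply: contraNneq => q0.
apply/eqP; apply: co_sep => i iN.
have aN : (i./2 < N)%N by lia.
have /eqP := psumr_eq0P ge0 q0 (i := Ordinal aN) isT.
rewrite mulf_eq0 gt_eqF //= paddr_eq0 -?expr2 ?sqr_ge0 // !expf_eq0 /=.
case/andP=> /eqP even0 /eqP odd0; rewrite -(odd_double_half i).
by case: (odd i); rewrite ?add1n ?add0n.
Qed.

Lemma pair_dotJ x y : pair_dot (pairJ x) (pairJ y) = pair_dot x y.
Proof.
apply: eq_bigr => a _; have [-> ->] := coord_pairJ x (ltn_ord a).
have [-> ->] := coord_pairJ y (ltn_ord a).
by rewrite mulrNN ![s a * _ * (s a * _)]mulrACA !s_sign !mul1r addrC.
Qed.

Lemma pair_form x y : pair_dot x (pairJ y) =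
  \sum_(a < N) mu a * s a * (co a.*2.+1 x * co a.*2 y - co a.*2 x * co a.*2.+1 y).
Proof.
apply: eq_bigr => a _; have [-> ->] := coord_pairJ y (ltn_ord a).
ring.
Qed.

Lemma pair_form_C x y : pair_dot y (pairJ x) = - pair_dot x (pairJ y).
Proof. by rewrite !pair_form -sumrN; apply: eq_bigr => a _; ring. Qed.

Lemma pair_form_unpaired i j : (i < N * 2)%N -> (j < N * 2)%N -> i./2 != j./2 ->
  pair_dot (c i) (pairJ (c j)) = 0.
Proof.
move=> iN jN ij; rewrite pair_form big1 // => a _; have := ltn_ord a => aN.
rewrite !co_dual; try lia.
rewrite -!natrM !mulnb (_ : _ && _ = false); last lia.
by rewrite (_ : _ && _ = false) ?subrr ?mulr0 //; lia.
Qed.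

Lemma pair_form_paired a : (a < N)%N ->
  pair_dot (c a.*2) (pairJ (c a.*2.+1)) = - (mu a * s a).
Proof.
move=> aN; rewrite pair_form (bigD1 (Ordinal aN)) //= big1 => [|b].
  rewrite !co_dual; try lia.
  by rewrite !eq_doubleE !eqxx /=; ring.
rewrite -val_eqE /= => /negbTE ba; have := ltn_ord b => bN.
rewrite !co_dual; try lia.
by rewrite !eq_doubleE ba /=; ring.
Qed.

Variable v : nat -> R.

Definition pair_bracket x y : R :=
  \sum_(a < N) v a * (co a.*2 x * co a.*2.+1 y - co a.*2.+1 x * co a.*2 y).

Lemma pair_bracketJ x y : pair_bracket (pairJ x) (pairJ y) = pair_bracket x y.
Proof.
apply: eq_bigr => a _; have [-> ->] := coord_pairJ x (ltn_ord a).
have [-> ->] := coord_pairJ y (ltn_ord a).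
by rewrite mulNr mulrN opprK ![s a * _ * (s a * _)]mulrACA !s_sign !mul1r addrC.
Qed.

Lemma pair_bracket_unpaired i j : (i < N * 2)%N -> (j < N * 2)%N -> i./2 != j./2 ->
  pair_bracket (c i) (c j) = 0.
Proof.
move=> iN jN ij; rewrite /pair_bracket big1 // => a _; have := ltn_ord a => aN.
rewrite !co_dual; try lia.
rewrite -!natrM !mulnb (_ : _ && _ = false); last lia.
by rewrite (_ : _ && _ = false) ?subrr ?mulr0 //; lia.
Qed.

Lemma pair_bracket_paired a : (a < N)%N -> pair_bracket (c a.*2) (c a.*2.+1) = v a.
Proof.
move=> aN; rewrite /pair_bracket (bigD1 (Ordinal aN)) //= big1 => [|b].
  rewrite !co_dual; try lia.
  by rewrite !eq_doubleE !eqxx /=; ring.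
rewrite -val_eqE /= => /negbTE ba; have := ltn_ord b => bN.
rewrite !co_dual; try lia.
by rewrite !eq_doubleE ba /=; ring.
Qed.

Lemma pair_bracket_c0 x : v 0%N = 0 -> pair_bracket x (c 0%N) = 0.
Proof.
move=> v0; rewrite /pair_bracket big1 // => a _; have := ltn_ord a => aN.
rewrite !co_dual; try lia.
case: a aN => [[|a] /= ? ?]; first by rewrite v0 mul0r.
by rewrite !mulr0 subrr mulr0.
Qed.

(** The balanced condition reduces to a trace condition: the pair [a] occurs in
    d(F^M) with the product of the f-values of the other pairs, that is, the
    total product divided by [- (mu a * s a)]. *)
Lemma abelian_balanced_of_trace m :
  N = m.+2 -> \dim {:g} = (N * 2)%N -> v 0%N = 0 ->
  (forall x y, [lie x, y] = pair_bracket x y *: c 0%N) ->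
  \sum_(a < N) v a / (mu a * s a) = 0 ->
  exists (J : 'End(g)) (ip : {dot g for idfun}), abelian_balanced_hermitian J ip.
Proof.
move=> Nm dimg v0 lieE trace0.
pose JL : {linear g -> g} :=
  HB.pack pairJ (GRing.isLinear.Build R g g _ pairJ pairJ_linear).
have JE x : linfun JL x = pairJ x by rewrite lfunE.
have [ip ipE] := dot_exists pair_dot_linear pair_dotC pair_dot_gt0.
have J_abelian x y : [lie pairJ x, pairJ y] = [lie x, y].
  by rewrite !lieE pair_bracketJ.
exists (linfun JL), ip; split.
- split; last by move=> x y; rewrite !JE !ipE pair_dotJ.
  split=> [x|x y]; rewrite !JE; first exact: pairJK.
  have -> : [lie x, pairJ y] = - [lie pairJ x, y].
    by rewrite -J_abelian pairJK lieNr.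
  have JN u : pairJ (- u) = - pairJ u := linearN JL u.
  by rewrite J_abelian JN opprK subrK subrr.
- by move=> x y; rewrite !JE J_abelian.
have -> : balanced (linfun JL) ip <-> forall x,
    CE_d (ext_pow (fun x : 'I_2 -> g => pair_dot (x ord0) (pairJ (x ord_max))) m.+1) x = 0.
  rewrite /balanced; have -> : (\dim {:g})./2.-1 = m.+1 by rewrite dimg Nm muln2 doubleK.
  have -> // : fundamental_form (linfun JL) ip =
    (fun x : 'I_2 -> g => pair_dot (x ord0) (pairJ (x ord_max))).
  by apply: funext => x; rewrite /fundamental_form JE ipE.
pose P := \prod_(a < N) - (mu a * s a).
have unit_pair a : mu a * s a != 0.
  rewrite mulf_neq0 ?(gt_eqF (mu_gt0 _)) //; apply/eqP => s0.
  by have /eqP := s_sign a; rewrite s0 mul0r eq_sym oner_eq0.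
move: (pair_form_unpaired) (pair_bracket_unpaired) (adapted_span).
rewrite Nm => funp bunp spanN.
apply: (@CE_d_pow_eq0 _ _ (c 0%N) pair_bracket lieE _ (fun x y => pair_dot x (pairJ y)) m c
  (fun a => v a.+1) _ _ erefl _ _ _ (fun i => co i)).
- by move=> x; rewrite lieE pair_bracket_c0 ?scale0r.
- exact: pair_form_C.
- move=> k u w x; have -> : pairJ (k *: u + w) = k *: pairJ u + pairJ w.
    exact: pairJ_linear.
  exact: pair_dot_linear.
- exact: funp.
- by move=> i j iN jN ij; rewrite lieE bunp // scale0r.
- by move=> a am; rewrite lieE pair_bracket_paired // Nm.
- exact: spanN.
rewrite (eq_bigr (fun a : 'I_m.+1 => - P * (v a.+1 / (mu a.+1 * s a.+1)))) => [|a _].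
  rewrite -mulr_sumr; move: trace0; rewrite Nm big_ord_recl /= v0 mul0r add0r => ->.
  by rewrite mulr0.
have aN : (a.+1 < N)%N by rewrite Nm ltnS.
have -> : P = - (mu a.+1 * s a.+1) * \prod_(b < m.+1)
    pair_dot (c (bump a.+1 b).*2) (pairJ (c (bump a.+1 b).*2.+1)).
  rewrite /P Nm (bigD1_ord (lift ord0 a)) //=; congr (_ * _).
  apply: eq_bigr => b _; rewrite pair_form_paired // Nm /bump.
  have := ltn_ord b; case: leqP; lia.
move: (unit_pair a.+1); move: (mu a.+1 * s a.+1) (\prod_(b < _) _) => X Q X0.
by field.
Qed.

End AdaptedBasis.

(** * Orthogonal J-invariant planes *)

Lemma common_zero (K : fieldType) (V : vectType K) p (L : 'I_p -> V -> K) :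
  (forall i k u v, L i (k *: u + v) = k * L i u + L i v) -> (p < \dim {:V})%N ->
  exists2 v, v != 0 & forall i, L i v = 0.
Proof.
move=> L_linear pV; pose LV v : 'rV[K]_p := \row_i L i v.
have LV_linear : linear LV by move=> k u v; apply/rowP => i; rewrite !mxE L_linear.
pose LL : {linear V -> 'rV[K]_p} :=
  HB.pack LV (GRing.isLinear.Build K V 'rV[K]_p _ LV LV_linear).
have := limg_ker_dim (linfun LL) fullv; rewrite capfv => dimE.
have dim_img : (\dim (linfun LL @: fullv) <= p)%N.
  by apply: leq_trans (dimvS (subvf _)) _; rewrite dimvf /= /dim /= mul1n.
have /subvPn[v] : ~~ (lker (linfun LL) <= 0)%VS.
  by rewrite subv0 -dimv_eq0; lia.
rewrite memv_ker memv0 => /eqP v0 vn0; exists v => // i.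
have /rowP/(_ i) : LV v = 0 by rewrite -v0 lfunE.
by rewrite !mxE.
Qed.

Section ComplexOrthogonal.
Variables (R : realFieldType) (g : lieAlgebraType R) (J : 'End(g)) (ip : {dot g for idfun}).
Hypothesis JK : forall x, J (J x) = - x.
Hypothesis ipJ : forall x y, ip (J x) (J y) = ip x y.

Lemma dotC x y : ip y x = ip x y.
Proof. by rewrite (hermC _ y x) expr0 mul1r. Qed.

Lemma dot_linear k u v x : ip x (k *: u + v) = k * ip x u + ip x v.
Proof. exact: (linearPr ip). Qed.

Lemma dot_gt0 x : x != 0 -> 0 < ip x x.
Proof. exact: neq0_dnorm_gt0. Qed.

Lemma dot0r x : ip x 0 = 0.
Proof. by have := dot_linear (-1) 0 0 x; rewrite scaler0 addr0 mulN1r addNr. Qed.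

Lemma dotNr x y : ip x (- y) = - ip x y.
Proof. by rewrite -[- y]addr0 -scaleN1r dot_linear dot0r mulN1r addr0. Qed.

Lemma dotJ x y : ip (J x) y = - ip x (J y).
Proof. by rewrite -[ip x _]ipJ JK dotNr opprK. Qed.

(** Gram-Schmidt by dimension count: being in the kernel of [L] and orthogonal
    to all [u a] and [J (u a)] found so far amounts to fewer linear conditions
    than the dimension.  The functionals [L] cut out the centre in the
    application. *)
Lemma orthogonal_lines q (L : 'I_q -> g -> R) z m :
  (forall i k u v, L i (k *: u + v) = k * L i u + L i v) ->
  z != 0 -> (forall i, L i z = 0) -> (q + m.+1 * 2 <= \dim {:g})%N ->
  exists u : nat -> g, [/\ u 0%N = z,
    forall a, (a <= m)%N -> u a != 0 /\ forall i, L i (u a) = 0 &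
    forall a b, (a < b)%N -> (b <= m)%N -> ip (u b) (u a) = 0 /\ ip (u b) (J (u a)) = 0].
Proof.
move=> L_linear z0 Lz; elim: m => [|m IHm] dim_m.
  exists (fun=> z); split=> // a b; lia.
have [|u [u0 uL u_orth]] := IHm; first lia.
pose L' (i : 'I_(q + (m.+1 + m.+1))) v := match split i with
  | inl j => L j v
  | inr j => match split j with inl a => ip (u a) v | inr a => ip (J (u a)) v end
  end.
have [||v v0 Lv] := @common_zero R g _ L'.
- by move=> i k x y; rewrite /L'; case: split => [j|j] //; case: split => a; rewrite dot_linear.
- lia.
exists (fun a => if a == m.+1 then v else u a); split=> //.
  move=> a am /=; have [_|am'] := eqVneq a m.+1; last by apply: uL; lia.
  by split=> // i; have := Lv (lshift _ i); rewrite /L' (unsplitK (inl _)).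
move=> a b ab bm /=; rewrite (_ : (a == m.+1) = false); last lia.
have [_|bm'] := eqVneq b m.+1; last by apply: u_orth; lia.
have am : (a < m.+1)%N by lia.
have := Lv (rshift q (lshift m.+1 (Ordinal am))).
rewrite /L' (unsplitK (inr _)) (unsplitK (inl _)) /= dotC => ->.
have := Lv (rshift q (rshift m.+1 (Ordinal am))).
by rewrite /L' (unsplitK (inr _)) (unsplitK (inr _)) /= dotC => ->.
Qed.

Definition pair_up (u : nat -> g) i := if odd i then J (u i./2) else u i./2.

(** For indices in different pairs, moving J across the dot product reduces every
    value of the form to one of the orthogonality relations. *)
Lemma pair_up_form (u : nat -> g) m :
  (forall a b, (a < b)%N -> (b <= m)%N -> ip (u b) (u a) = 0 /\ ip (u b) (J (u a)) = 0) ->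
  forall i j, (i < m.+1 * 2)%N -> (j < m.+1 * 2)%N -> i./2 != j./2 ->
  ip (pair_up u i) (J (pair_up u j)) = 0.
Proof.
move=> u_orth i j im jm ij.
have orth a b : a != b -> (a <= m)%N -> (b <= m)%N ->
    ip (u a) (u b) = 0 /\ ip (u a) (J (u b)) = 0.
  move=> ab am bm; have [ba|ab'|/eqP] := ltngtP b a; last by rewrite eq_sym (negbTE ab).
    exact: u_orth.
  have [o1 o2] := u_orth a b ab' bm.
  by rewrite dotC o1 -dotC dotJ o2 oppr0.
have [||o1 o2] := orth _ _ ij; try lia.
by rewrite /pair_up; do 2 case: odd; rewrite ?JK ?dotNr ?ipJ ?dotJ ?JK ?dotNr ?o1 ?o2 ?oppr0.
Qed.

End ComplexOrthogonal.

(** * The product of a Heisenberg and an abelian Lie algebra *)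

Section HeisenbergTimesAbelian.
Variables (R : realType) (n m : nat).
Local Notation H := (heisenberg R n).
Local Notation A := (abelian_lie R m).
Local Notation V := (H * A)%type.

Definition abel_coef (x : A) t : R := \sum_(j < m | j == t :> nat) (x : 'rV[R]_m) 0 j.
Definition abel_e t : A := (\row_j (j == t :> nat)%:R : 'rV[R]_m).

(** The order puts z and an abelian vector first, so that they form pair 0; the
    Heisenberg pairs are 1, ..., n, and the other abelian vectors follow. *)
Definition adapted_basis (i : nat) : V :=
  match i with
  | 0 => (heis_z R n, 0)
  | 1 => (0, abel_e 0)
  | j.+2 => if (j < n.*2)%N then (heis_e R n j, 0) else (0, abel_e (j - n.*2).+1)
  end.

Definition adapted_coord (i : nat) (x : V) : R :=
  match i with
  | 0 => heis_coef x.1 n.*2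
  | 1 => abel_coef x.2 0
  | j.+2 => if (j < n.*2)%N then heis_coef x.1 j else abel_coef x.2 (j - n.*2).+1
  end.

Lemma abel_coef_linear k (u v : A) t :
  abel_coef (k *: u + v) t = k * abel_coef u t + abel_coef v t.
Proof.
rewrite /abel_coef mulr_sumr -big_split; apply: eq_bigr => j _.
by rewrite !mxE.
Qed.

Lemma abel_coef_e s t : (t < m)%N -> abel_coef (abel_e s) t = (t == s)%:R.
Proof.
move=> tm; rewrite /abel_coef (big_pred1 (Ordinal tm)) ?mxE // => j.
Qed.

Lemma heis_coef0 t : heis_coef (0 : H) t = 0.
Proof. by rewrite /heis_coef mxE. Qed.

Lemma abel_coef0 t : abel_coef 0 t = 0.
Proof. by rewrite /abel_coef big1 // => j _; rewrite mxE. Qed.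

Lemma heis_coef_basis s t : (s <= n.*2)%N -> (t <= n.*2)%N ->
  heis_coef (heis_e R n s) t = (t == s)%:R.
Proof. by move=> sn tn; rewrite /heis_coef mxE eqxx /= -val_eqE /= !inordK ?ltnS. Qed.

Lemma heis_zE : heis_z R n = heis_e R n n.*2.
Proof. by congr delta_mx; apply: val_inj; rewrite /= inordK. Qed.

Lemma adapted_coord_linear i k u v :
  adapted_coord i (k *: u + v) = k * adapted_coord i u + adapted_coord i v.
Proof.
case: i => [|[|i]] /=; rewrite ?heis_coefP ?abel_coef_linear //.
by case: ifP => _; rewrite ?heis_coefP ?abel_coef_linear.
Qed.

Lemma adapted_coord_dual i j : (i < n.*2.+1 + m)%N -> (j < n.*2.+1 + m)%N -> (0 < m)%N ->
  adapted_coord i (adapted_basis j) = (i == j)%:R.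
Proof.
move=> im jm m0.
have cH (b : bool) x y t : heis_coef (if b then (x, 0) else (0, y) : V).1 t =
  if b then heis_coef x t else 0 by case: b => //=; rewrite heis_coef0.
have cA (b : bool) x y t : abel_coef (if b then (x, 0) else (0, y) : V).2 t =
  if b then 0 else abel_coef y t by case: b => //=; rewrite abel_coef0.
case: i im => [|[|i]] im; case: j jm => [|[|j]] jm /=;
  rewrite ?heis_zE ?heis_coef0 ?abel_coef0 ?cH ?cA //;
  repeat case: ltnP => ?; rewrite ?heis_coef0 ?abel_coef0 ?heis_coef_basis ?abel_coef_e //;
  try lia; try (by congr (nat_of_bool _)%:R; lia); rewrite ?eqxx // (_ : (_ == _) = false) //; lia.
Qed.

Lemma adapted_coord_sep x : (0 < m)%N ->
  (forall i, (i < n.*2.+1 + m)%N -> adapted_coord i x = 0) -> x = 0.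
Proof.
move=> m0 x0; apply: injective_projections; apply/rowP => j; rewrite mxE.
  rewrite -[j]inord_val -[LHS]/(heis_coef x.1 j); have := ltn_ord j.
  rewrite ltnS leq_eqVlt => /orP[/eqP->|jn]; first exact: (x0 0%N).
  by have := x0 j.+2; rewrite /= jn; apply; lia.
have -> : (x.2 : 'rV[R]_m) 0 j = abel_coef x.2 j.
  by rewrite /abel_coef (big_pred1 j).
case: (val j) (ltn_ord j) => [|t] tm; first by apply: (x0 1%N); lia.
have tE : (n.*2 + t < n.*2)%N = false by lia.
by have := x0 (n.*2 + t).+2; rewrite /= tE addKn; apply; lia.
Qed.

Lemma dim_heis_abel : \dim {:V} = (n.*2.+1 + m)%N.
Proof. by rewrite dimvf /dim /= /dim /= !mul1n. Qed.

End HeisenbergTimesAbelian.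

Lemma heis_abel_bracket (R : realType) n k
    (x y : (heisenberg R n * abelian_lie R (2 * k + 1))%type) :
  [lie x, y] = pair_bracket (n + k).+1 (@adapted_coord R n (2 * k + 1))
    (fun a => ((0 < a) && (a <= n))%N%:R) x y *: adapted_basis R n (2 * k + 1) 0.
Proof.
apply: injective_projections; last by rewrite /= scaler0.
rewrite [LHS]/= /heis_bracket; congr (_ *: _).
rewrite /pair_bracket big_ord_recl mul0r add0r big_split_ord /= [X in _ + X]big1 ?addr0.
  rewrite /heis_omega; apply: eq_bigr => a _; have := ltn_ord a => an.
  by rewrite /bump /= add1n an mul1r add0n !ifT //; lia.
by move=> a _; rewrite /bump /= add1n ltnNge leq_addr mul0r.
Qed.

Lemma abelian_balanced_heis_abel (R : realType) (n k : nat) : (2 <= n)%N ->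
  exists (J : 'End((heisenberg R n * abelian_lie R (2 * k + 1))%type))
         (g : {dot (heisenberg R n * abelian_lie R (2 * k + 1))%type for idfun}),
    abelian_balanced_hermitian J g.
Proof.
move=> n2; pose m := (2 * k + 1)%N; pose V := (heisenberg R n * abelian_lie R m)%type.
have dimV : \dim {:V} = ((n + k).+1 * 2)%N by rewrite dim_heis_abel /m; lia.
(* On the Heisenberg pairs 1 / (mu a * s a) is - 1 once and 1 / (n - 1) on the
   n - 1 others. *)
pose s a : R := if a == 1%N then -1 else 1.
pose mu a : R := if a == 1%N then 1 else n.-1%:R.
have co_dual i j : (i < (n + k).+1 * 2)%N -> (j < (n + k).+1 * 2)%N ->
    adapted_coord i (adapted_basis R n m j) = (i == j)%:R.
  by move=> iN jN; apply: adapted_coord_dual; rewrite /m; lia.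
have co_sep (x : V) : (forall i, (i < (n + k).+1 * 2)%N -> adapted_coord i x = 0) -> x = 0.
  move=> x0; apply: adapted_coord_sep; rewrite /m; first lia.
  by move=> i im; apply: x0; lia.
have s_sign a : s a * s a = 1 by rewrite /s; case: ifP; rewrite ?mulrNN mul1r.
have mu_gt0 a : 0 < mu a by rewrite /mu; case: ifP; rewrite ?ltr01 // ltr0n; lia.
apply: (abelian_balanced_of_trace (@adapted_coord_linear R n m) co_dual co_sep s_sign mu_gt0
  (m := (n + k).-1) _ dimV _ (@heis_abel_bracket R n k)) => //; first lia.
rewrite big_ord_recl mul0r add0r big_split_ord /= [X in _ + X]big1 ?addr0; last first.
  by move=> a _; rewrite /bump /= add1n ltnNge leq_addr mul0r.
case: n n2 {V dimV co_dual co_sep} @mu mu_gt0 => [|[|n]] // _ mu mu_gt0.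
rewrite big_ord_recl /= (eq_bigr (fun=> n.+1%:R^-1)) => [|a _]; last first.
  by rewrite /bump /= !add1n ltnS ltn_ord /mu /s /= mulr1 mul1r.
rewrite sumr_const card_ord -[_ *+ n.+1]mulr_natl divff ?pnatr_eq0 // /mu /s /= mul1r mul1r.
by rewrite invrN1 addNr.
Qed.

Lemma not_abelian_balanced_heis3 (R : realType) (k : nat)
    (J : 'End((heisenberg R 1 * abelian_lie R (2 * k + 1))%type))
    (ip : {dot (heisenberg R 1 * abelian_lie R (2 * k + 1))%type for idfun}) :
  ~ abelian_balanced_hermitian J ip.
Proof.
move=> [[[JK _] ipJ] J_abelian J_balanced].
pose m := (2 * k + 1)%N; pose V := (heisenberg R 1 * abelian_lie R m)%type.
have dimV : \dim {:V} = ((1 + k).+1 * 2)%N by rewrite dim_heis_abel /m; lia.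
(* The common kernel of these two coordinates is the centre. *)
pose L (i : 'I_2) (x : V) := heis_coef x.1 i.
pose z : V := (heis_z R 1, 0).
pose e i : V := (heis_e R 1 i, 0).
have L_linear i c u v : L i (c *: u + v) = c * L i u + L i v by rewrite /L heis_coefP.
have lieE (x y : V) : [lie x, y] =
    (heis_coef x.1 0 * heis_coef y.1 1 - heis_coef x.1 1 * heis_coef y.1 0) *: z.
  apply: injective_projections => /=; last by rewrite scaler0.
  by rewrite /lie /= /heis_bracket /heis_omega big_ord1.
have heis_z0 : heis_z R 1 != 0.
  apply/eqP => /(congr1 (fun x => heis_coef x 2)).
  by rewrite heis_zE heis_coef_basis // heis_coef0 => /eqP; rewrite oner_eq0.
have z0 : z != 0 by apply: contra heis_z0 => /eqP[->].
have central (x : V) : (forall i, L i x = 0) -> forall y, [lie y, x] = 0.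
  move=> Lx y; rewrite lieE -[heis_coef x.1 1]/(L (@Ordinal 2 1 isT) x).
  by rewrite -[heis_coef x.1 0]/(L ord0 x) !Lx !mulr0 subrr scale0r.
have e_coef i j : (i < 3)%N -> (j < 3)%N -> heis_coef (e i).1 j = (j == i)%:R.
  by move=> i3 j3; rewrite heis_coef_basis.
have Lcentral (x : V) : (forall y, [lie y, x] = 0) -> forall i, L i x = 0.
  move=> xc [[|[|//]] i2].
  - have /eqP := xc (e 1%N); rewrite lieE !e_coef // scaler_eq0 (negbTE z0) orbF.
    by rewrite mul0r sub0r mul1r oppr_eq0 => /eqP.
  - have /eqP := xc (e 0%N); rewrite lieE !e_coef // scaler_eq0 (negbTE z0) orbF.
    by rewrite mul0r subr0 mul1r => /eqP.
(* J x is central because [y, J x] = [J (- J y), J x] = [- J y, x]. *)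
have LJ (x : V) : (forall i, L i x = 0) -> forall i, L i (J x) = 0.
  move=> Lx; apply: Lcentral => y.
  by rewrite -[y]opprK -JK J_abelian central.
have Lz i : L i z = 0.
  by case: i => [[|[|i]] i2] //; rewrite /L /z /= heis_zE heis_coef_basis.
have [|u [u0 uL u_orth]] := orthogonal_lines (m := k) J ip L_linear z0 Lz.
  by rewrite dimV; lia.
have pairs := pair_up_form JK ipJ u_orth.
have uJL i : (i < k.+1 * 2)%N -> forall l, L l (pair_up J u i) = 0.
  move=> ik; rewrite /pair_up; case: odd; [apply: LJ|]; apply uL; lia.
have formC (x y : V) : ip y (J x) = - ip x (J y).
  by rewrite -(dotJ JK ipJ) dotC.
have form_lin (c : R) (a b x : V) : ip x (J (c *: a + b)) = c * ip x (J a) + ip x (J b).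
  by rewrite linearP dot_linear.
have pow_lin := multilinear_ext_pow (m := k.+1) (multilinear_form2 formC form_lin).
have := J_balanced.
rewrite /balanced (_ : (\dim {:_})./2.-1 = k.+1); last by rewrite dimV; lia.
(* The argument z is left out: the bracket of the first two arguments
   supplies it. *)
move/(_ (fcons (e 0%N) (fcons (e 1%N) (fun l : 'I_(k * 2).+1 => pair_up J u l.+1)))).
rewrite (CE_d_central_tail _ _ pow_lin); last first.
  by move=> l; apply: central; apply: uJL; exact: (ltn_ord l).
have -> : fcons [lie e 0%N, e 1%N] (fun l : 'I_(k * 2).+1 => pair_up J u l.+1)
        = (fun i : 'I_(k.+1 * 2) => pair_up J u i).
  apply: funext => i; case: (unliftP ord0 i) => [l|] ->; first by rewrite fconsS.
  by rewrite fcons0 lieE !e_coef // mulr1 mulr0 subr0 scale1r /pair_up /= u0.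
rewrite (ext_pow_pairs formC pairs) => /eqP.
rewrite oppr_eq0 mulf_eq0 pnatr_eq0 gtn_eqF ?fact_gt0 //= => /prodf_eq0[a _].
apply/negP.
rewrite /pair_up /= odd_double doubleK uphalf_double JK dotNr oppr_eq0.
by rewrite gt_eqF // dot_gt0 //; have [] := uL a (ltn_ord a).
Qed.

Theorem proposition4p2 (R : realType) (n k : nat) (hn : (1 <= n)%N) :
  (exists (J : 'End((heisenberg R n * abelian_lie R (2 * k + 1))%type))
          (g : {dot (heisenberg R n * abelian_lie R (2 * k + 1))%type for idfun}),
     abelian_balanced_hermitian J g)
  <-> (2 <= n)%N.
Proof.
split=> [[J [g Jg]]|]; last exact: abelian_balanced_heis_abel.
have [//|n1] := ltnP 1 n; have nE : n = 1%N by lia.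
by subst n; case: (not_abelian_balanced_heis3 Jg).
Qed.
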